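(* Let $1\to N\to G\to H\to 1$ be a short exact sequence of (discrete) groups. Suppose that $N$ satisfies Kaplansky's complex zero-divisor conjecture and that $H$ is a unique product group. Then $G$ satisfies Kaplansky's complex zero-divisor conjecture and the complex idempotent conjecture.
   Context: For a group $G$, $\mathbb{C}[G]$ denotes the complex group ring. A group $G$ is said to satisfy Kaplansky's complex zero-divisor conjecture if $\mathbb{C}[G]$ is a domain, i.e. the product of any two nonzero elements of $\mathbb{C}[G]$ is nonzero (this forces $G$ to be torsion-free). A group $G$ is said to satisfy the complex idempotent conjecture if the only idempotents of $\mathbb{C}[G]$ are $0$ and the identity element. A group $H$ is a unique product group if for any two non-empty finite subsets $A,B\subseteq H$ there exists at least one element $h\in H$ which has a unique representation of the form $h=ab$ with $a\in A$ and $b\in B$. *)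

(* Defs.v *)
From HB Require Import structures.
From mathcomp Require Import all_boot all_order all_algebra.
From mathcomp Require Import finmap complex reals.
From mathcomp.multinomials Require Import monalg.
Set Implicit Arguments.
Unset Strict Implicit.
Unset Printing Implicit Defensive.

Import GRing.Theory.
Local Open Scope fset_scope.
Local Open Scope ring_scope.

(* The monoid-algebra ring structure on {malg R[K]} cannot be used here: it is
   only available when K is a monomType, in which x * y = 1 forces x = y = 1.
   Only its module structure, which exists for every choiceType K, is reused. *)
Definition group_ring (R : nzRingType) (G : groupType) : Type := {malg R[G]}.

HB.instance Definition _ (R : nzRingType) (G : groupType) :=
  GRing.Lmodule.on (group_ring R G).

Section GroupRing.
Context (R : nzRingType) (G : groupType).
Implicit Types (x y z : group_ring R G) (g h : G).

Definition group_ring_one : group_ring R G := << 1 *g 1%g >>.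

Definition group_ring_mul x y : group_ring R G :=
  \sum_(g <- msupp x) \sum_(h <- msupp y) << x@_g * y@_h *g (g * h)%g >>.

Local Notation one := group_ring_one.
Local Notation mul := group_ring_mul.

Lemma group_ring_mulw (d1 d2 : {fset G}) x y :
  msupp x `<=` d1 -> msupp y `<=` d2 ->
  mul x y = \sum_(g <- d1) \sum_(h <- d2) << x@_g * y@_h *g (g * h)%g >>.
Proof.
move=> le1 le2; rewrite /mul (big_fset_incl _ le1) /=.
  apply: eq_bigr => g _; apply: big_fset_incl => // h _ /mcoeff_outdom ->.
  by rewrite mulr0 monalgU0.
move=> g _ /mcoeff_outdom xg.
by rewrite big1 // => h _; rewrite xg mul0r monalgU0.
Qed.

Lemma group_ring_mulUU (a b : R) g h :
  mul << a *g g >> << b *g h >> = << a * b *g (g * h)%g >>.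
Proof.
by rewrite (group_ring_mulw msuppU_le msuppU_le) !big_seq_fset1 !mcoeffUU.
Qed.

Lemma group_ring_mulDl : left_distributive mul +%R.
Proof.
move=> x y z.
rewrite (group_ring_mulw (msuppD_le x y) (fsubset_refl (msupp z))).
rewrite (group_ring_mulw (fsubsetUl _ (msupp y)) (fsubset_refl (msupp z))).
rewrite (group_ring_mulw (fsubsetUr (msupp x) _) (fsubset_refl (msupp z))).
rewrite -big_split /=; apply: eq_bigr => g _.
rewrite -big_split /=; apply: eq_bigr => h _.
by rewrite mcoeffD mulrDl monalgUD.
Qed.

Lemma group_ring_mulDr : right_distributive mul +%R.
Proof.
move=> x y z.
rewrite (group_ring_mulw (fsubset_refl (msupp x)) (msuppD_le y z)).
rewrite (group_ring_mulw (fsubset_refl (msupp x)) (fsubsetUl _ (msupp z))).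
rewrite (group_ring_mulw (fsubset_refl (msupp x)) (fsubsetUr (msupp y) _)).
rewrite -big_split /=; apply: eq_bigr => g _.
rewrite -big_split /=; apply: eq_bigr => h _.
by rewrite mcoeffD mulrDr monalgUD.
Qed.

Lemma group_ring_mul0l : left_zero 0 mul.
Proof. by move=> x; rewrite /mul msupp0 big_seq_fset0. Qed.

Lemma group_ring_mul0r : right_zero 0 mul.
Proof.
by move=> x; rewrite /mul msupp0 big1 // => g _; rewrite big_seq_fset0.
Qed.

Let mul_suml x I (r : seq I) F :
  mul (\sum_(i <- r) F i) x = \sum_(i <- r) mul (F i) x.
Proof.
exact: (big_morph (mul^~ x) (fun _ _ => group_ring_mulDl _ _ _)
                  (group_ring_mul0l _)).
Qed.

Let mul_sumr x I (r : seq I) F :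
  mul x (\sum_(i <- r) F i) = \sum_(i <- r) mul x (F i).
Proof.
exact: (big_morph (mul x) (fun _ _ => group_ring_mulDr _ _ _)
                  (group_ring_mul0r _)).
Qed.

Lemma group_ring_mul1l : left_id one mul.
Proof.
move=> x; rewrite [in LHS](monalgE x) mul_sumr [RHS]monalgE.
by apply: eq_bigr => g _; rewrite group_ring_mulUU mul1r mul1g.
Qed.

Lemma group_ring_mul1r : right_id one mul.
Proof.
move=> x; rewrite [in LHS](monalgE x) mul_suml [RHS]monalgE.
by apply: eq_bigr => g _; rewrite group_ring_mulUU mulr1 mulg1.
Qed.

Lemma group_ring_mulA : associative mul.
Proof.
move: mul mul_suml mul_sumr group_ring_mulUU => m suml sumr mUU x y z.
rewrite (monalgE x) !suml; apply: eq_bigr => g _.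
rewrite (monalgE y) suml !sumr suml; apply: eq_bigr => h _.
rewrite (monalgE z) !sumr; apply: eq_bigr => k _.
by rewrite !mUU mulrA mulgA.
Qed.

Lemma group_ring_oner_neq0 : one != 0.
Proof. by rewrite monalgU_eq0 oner_eq0. Qed.

HB.instance Definition _ := GRing.Zmodule_isNzRing.Build (group_ring R G)
  group_ring_mulA group_ring_mul1l group_ring_mul1r
  group_ring_mulDl group_ring_mulDr group_ring_oner_neq0.

End GroupRing.

Definition is_domain (A : nzRingType) : Prop :=
  forall x y : A, x != 0 -> y != 0 -> x * y != 0.

Definition only_trivial_idempotents (A : nzRingType) : Prop :=
  forall e : A, e * e = e -> e = 0 \/ e = 1.

Definition complex_zero_divisor_conjecture (R : realType) (G : groupType) :
  Prop := is_domain (group_ring R[i] G).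

Definition complex_idempotent_conjecture (R : realType) (G : groupType) :
  Prop := only_trivial_idempotents (group_ring R[i] G).

Definition unique_product_group (H : groupType) : Prop :=
  forall A B : {fset H}, A != fset0 -> B != fset0 ->
  exists h : H, exists! ab : H * H,
    [/\ ab.1 \in A, ab.2 \in B & h = (ab.1 * ab.2)%g].

(* Between groups, multiplicativity already implies preservation of 1 and
   inverses. *)
Definition short_exact (N G H : groupType)
    (i : {multiplicative N -> G}) (p : {multiplicative G -> H}) : Prop :=
  [/\ injective i,
      (forall g : G, p g = 1%g <-> exists n : N, i n = g)
    & (forall h : H, exists g : G, p g = h)].

(* Main.v *)
(* Collect the supports of nonzero x, y in C[G] along the fibres of p, and let
   h = ab be a unique product of the images of the two supports.  The
   coefficients of xy over h only involve those of x over a and of y over b.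
   Translating these two slices into N by elements g, k of the supports lying
   over a and b gives nonzero u, v in C[N] with
   (xy)(g n k) = (uv)(n) for all n in N, so xy is nonzero because uv is. *)
Require Import Defs.
From mathcomp Require Import all_boot all_order all_algebra.
From mathcomp Require Import finmap boolp reals.
From mathcomp.multinomials Require Import monalg.
Set Implicit Arguments.
Unset Strict Implicit.
Unset Printing Implicit Defensive.

Import GRing.Theory.
Local Open Scope fset_scope.
Local Open Scope ring_scope.

(* mathcomp's gmulf1 and gmulfV require a UMagmaMorphism, so they do not apply
   to a bare {multiplicative G -> H}. *)
Lemma multiplicative1 (G H : groupType) (f : {multiplicative G -> H}) :
  f 1%g = 1%g.
Proof. by apply: (mulgI (f 1%g)); rewrite -gmulfM !mulg1. Qed.

Lemma multiplicativeV (G H : groupType) (f : {multiplicative G -> H}) :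
  {morph f : g / (g^-1)%g}.
Proof.
by move=> g; apply: (mulgI (f g)); rewrite -gmulfM !mulgV multiplicative1.
Qed.

(** For fixed [g], only [h = g^-1 * k] can contribute to the coefficient at [k]; if this [h] lies
    outside the support of [y], both sides are zero. *)
Lemma group_ring_mcoeffM (R : nzRingType) (G : groupType)
    (x y : group_ring R G) (k : G) :
  (x * y)@_k = \sum_(g <- msupp x) x@_g * y@_(g^-1 * k)%g.
Proof.
rewrite [x * y]/(group_ring_mul x y) /group_ring_mul raddf_sum.
apply: eq_bigr => g _; rewrite raddf_sum /=.
under eq_bigr => h _ do rewrite mcoeffU.
have kE h : (g * h == k)%g = (h == g^-1 * k)%g.
  by apply/eqP/eqP => [<-|->]; rewrite ?mulKg ?mulVKg.
under eq_bigr => h _ do rewrite kE.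
have [ky|ky] := boolP ((g^-1 * k)%g \in msupp y).
  rewrite (big_fsetD1 _ ky) /= eqxx mulr1n big_seq big1 ?addr0 // => h.
  by rewrite !inE => /andP[/negPf-> _]; rewrite mulr0n.
rewrite (mcoeff_outdom ky) mulr0 big_seq big1 // => h hy.
by case: eqP => // hE; rewrite -hE hy in ky.
Qed.

(** By additivity it suffices to treat a single term, which pulls back to a single term, by
    injectivity, or to 0. [f] is a bare function so as to cover translates of a morphism. *)
Lemma group_ring_pullback (R : nzRingType) (N G : groupType) (f : N -> G)
    (x : group_ring R G) :
  injective f -> exists u : group_ring R N, forall n, u@_n = x@_(f n).
Proof.
move=> f_inj; rewrite (monalgE x).
elim/big_ind: _ => [|y z [u uE] [v vE]|g _].
- by exists 0 => n; rewrite !mcoeff0.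
- by exists (u + v) => n; rewrite !mcoeffD uE vE.
have [[m <-]|gNf] := EM (exists m, f m = g).
  by exists << x@_(f m) *g m >> => n; rewrite !mcoeffU (inj_eq f_inj).
exists 0 => n; rewrite mcoeff0 mcoeffU; case: eqP => // gE.
by case: gNf; exists n.
Qed.

Lemma group_ring_extension_domain (R : nzRingType) (N G H : groupType)
    (i : {multiplicative N -> G}) (p : {multiplicative G -> H}) :
  short_exact i p -> is_domain (group_ring R N) -> unique_product_group H ->
  is_domain (group_ring R G).
Proof.
move=> [i_inj kerp _] domN upH x y x0 y0.
have supp_neq0 (z : group_ring R G) : z != 0 -> p @` msupp z != fset0.
  apply: contraNneq => /fsetP pz0; apply/eqP/malgP => g; rewrite mcoeff0.
  apply/mcoeff_outdom/negP => gz.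
  by have := pz0 (p g); rewrite !inE in_imfset.
have [h [[a b] [[/= aA bB hE] ab_uniq]]] :=
  upH _ _ (supp_neq0 _ x0) (supp_neq0 _ y0).
have /imfsetP[g /= gx aE] := aA; have /imfsetP[k /= ky bE] := bB.
have gi_inj : injective (fun n => g * i n)%g by move=> m n /mulgI/i_inj.
have ik_inj : injective (fun n => i n * k)%g by move=> m n /mulIg/i_inj.
have [u uE] := group_ring_pullback x gi_inj.
have [v vE] := group_ring_pullback y ik_inj.
have pi n : p (i n) = 1%g by apply/kerp; exists n.
(* At 1, [u] takes the value of [x] at [g], a point of its support; likewise [v] and [k] below. *)
have u0 : u != 0.
  apply: contraTneq gx => u0; rewrite -mcoeff_eq0.
  by have := uE 1%g; rewrite multiplicative1 mulg1 u0 mcoeff0 => <-.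
have v0 : v != 0.
  apply: contraTneq ky => v0; rewrite -mcoeff_eq0.
  by have := vE 1%g; rewrite multiplicative1 mul1g v0 mcoeff0 => <-.
have uvE n : (u * v)@_n = (x * y)@_(g * i n * k)%g.
  rewrite !group_ring_mcoeffM.
  have le_ux : [fset (g * i m)%g | m in msupp u] `<=` msupp x.
    apply/fsubsetP => _ /imfsetP[m /= mu ->].
    by rewrite -mcoeff_neq0 -uE mcoeff_neq0.
  (* The sum over the support of [x] is cut down to the coset of [g]; the remaining terms must
     vanish. *)
  rewrite -(big_fset_incl _ le_ux) => [|g' g'x g'Nu].
    rewrite big_imfset /=; last by move=> m n' _ _ /gi_inj.
    apply: eq_bigr => m _; rewrite uE vE gmulfM multiplicativeV; congr (_ * y@__).
    by rewrite invgM -!mulgA mulKg.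
  (* A nonzero term at [g'] would factor [h] through the two images, so uniqueness gives [p g' = a]
     and puts [g'] in the coset of [g]. *)
  rewrite [X in _ * X]mcoeff_outdom ?mulr0 //; apply: contra g'Nu => g'y.
  have [ag' _] : (a, b) = (p g', p (g'^-1 * (g * i n * k))%g).
    apply: ab_uniq; split; rewrite /= ?in_imfset //.
    by rewrite -gmulfM mulVKg !gmulfM pi mulg1 hE aE bE.
  have /kerp[m mE] : p (g^-1 * g')%g = 1%g.
    by rewrite gmulfM multiplicativeV -aE -ag' mulVg.
  have g'E : g' = (g * i m)%g by rewrite mE mulVKg.
  apply/imfsetP; exists m => //=.
  by rewrite -mcoeff_neq0 uE -g'E mcoeff_neq0.
apply: contraNneq (domN _ _ u0 v0) => xy0.
by apply/eqP/malgP => n; rewrite uvE xy0 !mcoeff0.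
Qed.

(** An idempotent satisfies [e * (1 - e) = 0], so one factor vanishes. *)
Lemma domain_only_trivial_idempotents (A : nzRingType) :
  is_domain A -> only_trivial_idempotents A.
Proof.
move=> domA e ee; have [->|e0] := eqVneq e 0; [by left | right].
apply/esym/eqP; rewrite -subr_eq0; apply: contraTT (eqxx (0 : A)) => e1.
by have := domA _ _ e0 e1; rewrite mulrBr mulr1 ee subrr.
Qed.

Theorem corollary3p6 (R : realType) (N G H : groupType)
    (i : {multiplicative N -> G}) (p : {multiplicative G -> H})
    (exact_ip : short_exact i p)
    (domN : complex_zero_divisor_conjecture R N)
    (upH : unique_product_group H) :
  complex_zero_divisor_conjecture R G /\ complex_idempotent_conjecture R G.
Proof.
have domG := group_ring_extension_domain exact_ip domN upH.
by split; last exact: domain_only_trivial_idempotents.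
Qed.
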